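(* Let $(X,d)$ be a complete metric space, let $f,g:X\to X$ be self-mappings, and let $f$ be a Suzuki type $(Z_G,g)$-contraction. Assume that (i) $f(X)\subseteq g(X)$, (ii) $g$ is continuous, and (iii) $f$ and $g$ are commuting, i.e. $fgx=gfx$ for all $x\in X$. Then $f$ and $g$ have a unique point of coincidence, i.e. there is exactly one $u\in X$ for which there exists $v\in X$ with $u=fv=gv$.
   Context: Metric spaces are assumed nonempty. A $C$-class function is a continuous map $G:[0,\infty)^2\to\mathbb{R}$ such that for all $s,t\in[0,\infty)$: $G(s,t)\le s$; and $G(s,t)=s$ implies $s=0$ or $t=0$. A map $G:[0,\infty)^2\to\mathbb{R}$ has property $C_G$ if there is a constant $C_G\ge 0$ such that (i) $G(s,t)>C_G$ implies $s>t$; (ii) $G(t,t)\le C_G$ for all $t\in[0,\infty)$. Fix a $C$-class function $G$ with property $C_G$, and fix the corresponding constant $C_G\ge 0$. A $C_G$-simulation function is a map $\zeta:[0,\infty)^2\to\mathbb{R}$ such that: (a) $\zeta(t,s)<G(s,t)$ for all $t,s>0$; (b) if $\{t_n\},\{s_n\}$ are sequences in $(0,\infty)$ with $\lim_{n\to\infty}t_n=\lim_{n\to\infty}s_n>0$ and $t_n<s_n$ for all $n$, then $\limsup_{n\to\infty}\zeta(t_n,s_n)<C_G$. $Z_G$ denotes the family of all $C_G$-simulation functions. For self-mappings $f,g$ of a metric space $(X,d)$, the mapping $f$ is a Suzuki type $(Z_G,g)$-contraction if there exists $\zeta\in Z_G$ such that for all $x,y\in X$ with $gx\ne gy$: $$\tfrac12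 d(gx,fx)<d(gx,gy)\ \Longrightarrow\ \zeta\big(d(fx,fy),d(gx,gy)\big)\ge C_G.$$ A point $u\in X$ is a point of coincidence of $f$ and $g$ if $u=fv=gv$ for some $v\in X$. *)

(* Defs.v *)
From HB Require Import structures.
From mathcomp Require Import all_boot all_order all_algebra.
From mathcomp Require Import all_classical all_reals all_analysis.

Set Implicit Arguments.
Unset Strict Implicit.
Unset Printing Implicit Defensive.

Import Order.TTheory GRing.Theory Num.Theory.
Import numFieldNormedType.Exports.

Local Open Scope classical_set_scope.
Local Open Scope ring_scope.

(* [Complete] includes [isPointed], so these spaces are nonempty. *)
#[short(type="completeMetricType")]
HB.structure Definition CompleteMetric (R : numDomainType) :=
  {T of Complete T & Metric R T}.

(* A map on [0, +oo[ ^ 2 is represented by a total function R -> R -> R whose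
   values are only constrained (or used) at nonnegative arguments. *)

Definition C_class (R : realType) (G : R -> R -> R) : Prop :=
  [/\ {within [set p : R * R | 0 <= p.1 /\ 0 <= p.2],
         continuous (fun p : R * R => G p.1 p.2)},
      forall s t : R, 0 <= s -> 0 <= t -> G s t <= s
    & forall s t : R, 0 <= s -> 0 <= t -> G s t = s -> s = 0 \/ t = 0].

Definition has_property_CG (R : realType) (G : R -> R -> R) (CG : R) : Prop :=
  [/\ 0 <= CG,
      forall s t : R, 0 <= s -> 0 <= t -> CG < G s t -> t < s
    & forall t : R, 0 <= t -> G t t <= CG].

(* The limit superior is taken in \bar R: [zeta (t n) (s n)] may tend to -oo. *)
Definition simulation_functions (R : realType) (G : R -> R -> R) (CG : R) :
    set (R -> R -> R) :=
  [set zeta |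
    (forall t s : R, 0 < t -> 0 < s -> zeta t s < G s t) /\
    (forall (t s : nat -> R) (l : R),
       (forall n, 0 < t n) -> (forall n, 0 < s n) ->
       t @ \oo --> l -> s @ \oo --> l -> 0 < l ->
       (forall n, t n < s n) ->
       (limn_esup (fun n => (zeta (t n) (s n))%:E) < CG%:E)%E)].

Definition Suzuki_contraction (R : realType) (G : R -> R -> R) (CG : R)
    (X : metricType R) (f g : X -> X) : Prop :=
  exists2 zeta, simulation_functions G CG zeta &
    forall x y : X, g x <> g y ->
      2^-1 * mdist (g x) (f x) < mdist (g x) (g y) ->
      CG <= zeta (mdist (f x) (f y)) (mdist (g x) (g y)).

Definition point_of_coincidence (X : Type) (f g : X -> X) (u : X) : Prop :=
  exists v : X, u = f v /\ u = g v.

(* Main.v *)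
Require Import Defs.
From HB Require Import structures.
From mathcomp Require Import all_boot all_order all_algebra.
From mathcomp Require Import all_classical all_reals all_analysis.
From mathcomp Require Import lra.

Import Order.TTheory GRing.Theory Num.Theory.
Import numFieldNormedType.Exports.

Local Open Scope classical_set_scope.
Local Open Scope ring_scope.

Set Implicit Arguments.
Unset Strict Implicit.
Unset Printing Implicit Defensive.

(** The simulation function serves only to produce a Meir-Keeler estimate
    (lemma [Suzuki_contraction_Meir_Keeler]): for every [l > 0] there is
    [delta > 0] such that every pair [x, y] satisfying the Suzuki premise
    [d(gx,fx) / 2 < d(gx,gy)] with [d(gx,gy) < l + delta] has
    [d(fx,fy) <= l - delta].  A failure of this estimate for arbitrarily small
    [delta] yields two sequences [d(fx_n,fy_n) < d(gx_n,gy_n)] tending to [l]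
    along which [zeta >= CG], against the limsup axiom.  Everything else is
    deduced from this estimate.

    Suppose that [f] and [g] never coincide.  Since [f(X)] lies in [g(X)],
    there is a sequence with [f x_n = g x_(n+1)].  Consecutive points satisfy
    the Suzuki premise, because [d(gx_n,fx_n) = d(gx_n,gx_(n+1)) > 0]; hence
    the steps [d(gx_n,gx_(n+1))] decrease, the estimate at their infimum shows
    that they tend to 0, and the estimate at [l = e] shows that [g x_n] is
    Cauchy.  Let [z] be its limit.  By commutation, [w_n = g x_n] is again a
    sequence with [f w_n = g w_(n+1)], and [g w_n] tends to [g z] by
    continuity.  Because the steps of [g w_n] decrease strictly, of any two
    consecutive indices one satisfies the Suzuki premise for the pair
    [w_n, z]; so [d(g w_(n+1), f z) < d(g w_n, g z)] for arbitrarily large [n],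
    which forces [f z = g z].  Uniqueness holds since the Suzuki premise is
    automatic when [x] is a coincidence point. *)

(** * The Meir-Keeler estimate *)

(** The premise [2^-1 * d(gx,fx) < d(gx,gy)] already forces [g x] and [g y] to
    be distinct. *)
Definition Suzuki_Meir_Keeler (R : realType) (X : metricType R) (f g : X -> X) :=
  forall l : R, 0 < l -> exists2 delta : R, 0 < delta &
    forall x y : X, 2^-1 * mdist (g x) (f x) < mdist (g x) (g y) ->
      mdist (g x) (g y) < l + delta -> mdist (f x) (f y) <= l - delta.

(** A family [r(n)] with [|r(n) - l| < l / (n + 1)] converges to [l] and stays
    positive: this is the scale at which the sequences for the limsup axiom are
    picked. *)
Lemma cvg_near_harmonic (R : realType) (l : R) (r : nat -> R) :
    0 < l -> (forall n, `|r n - l| < l / n.+1%:R) ->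
  (forall n, 0 < r n) /\ r @ \oo --> l.
Proof.
move=> l0 rl; split=> [n|].
  have : l / n.+1%:R <= l by rewrite ler_piMr ?(ltW l0)// invf_le1 ?ler1n ?ltr0n.
  by have := rl n; rewrite ltr_distl; move: (l / _) => e /andP[+ _]; lra.
apply/cvgrPdist_lt => e e0.
have el0 : 0 < e / l by rewrite divr_gt0.
near=> n.
rewrite distrC (lt_trans (rl n))// mulrC -ltr_pdivlMr//.
by near: n; exact: (near_infty_natSinv_lt (PosNum el0)).
Unshelve. all: by end_near. Qed.

Lemma limn_esup_ge_cst (R : realType) (u : nat -> \bar R) (l : \bar R) :
  (forall n, l <= u n)%E -> (l <= limn_esup u)%E.
Proof.
move=> lu; rewrite leNgt; apply/negP => ul.
have ucvg := limn_esup_le_cvg (ltW ul) lu.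
by move: ul; rewrite (cvg_limn_einf_sup ucvg).2 ltxx.
Qed.

Lemma Suzuki_contraction_Meir_Keeler (R : realType) (G : R -> R -> R) (CG : R)
    (X : metricType R) (f g : X -> X) :
  has_property_CG G CG -> Suzuki_contraction G CG f g -> Suzuki_Meir_Keeler f g.
Proof.
move=> [_ GltP _] [zeta [zetaG zeta_limsup] zetaP] l l0.
have zeta_ge x y : 2^-1 * mdist (g x) (f x) < mdist (g x) (g y) ->
    CG <= zeta (mdist (f x) (f y)) (mdist (g x) (g y)).
  move=> xy; apply: zetaP => // gxy.
  by move: xy; rewrite gxy mdistxx; have := mdist_ge0 (g y) (f x); lra.
have contr x y : 2^-1 * mdist (g x) (f x) < mdist (g x) (g y) ->
    mdist (f x) (f y) < mdist (g x) (g y).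
  move=> xy; have gxy0 : 0 < mdist (g x) (g y).
    by have := mdist_ge0 (g x) (f x); lra.
  have := mdist_ge0 (f x) (f y).
  rewrite le_eqVlt => /predU1P[<-//|fxy0].
  apply: GltP; rewrite ?mdist_ge0//.
  exact: le_lt_trans (zeta_ge _ _ xy) (zetaG _ _ fxy0 gxy0).
apply: contrapT => nodelta.
have /choice[p pP] : forall n : nat, exists p : X * X,
    [/\ 2^-1 * mdist (g p.1) (f p.1) < mdist (g p.1) (g p.2),
        mdist (g p.1) (g p.2) < l + l / n.+1%:R
      & l - l / n.+1%:R < mdist (f p.1) (f p.2)].
  move=> n; apply: contrapT => nop; apply: nodelta.
  exists (l / n.+1%:R); first by rewrite divr_gt0.
  move=> x y xy gxy; rewrite leNgt; apply/negP => fxy.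
  by apply: nop; exists (x, y).
pose t n := mdist (f (p n).1) (f (p n).2).
pose s n := mdist (g (p n).1) (g (p n).2).
have ts n : t n < s n by apply: contr; case: (pP n).
have [t0 tl] : (forall n, 0 < t n) /\ t @ \oo --> l.
  apply: cvg_near_harmonic => // n; have := ts n; rewrite /t /s ltr_distl.
  by case: (pP n) => _ s_lt t_gt ts_n; rewrite t_gt (lt_trans ts_n).
have [s0 sl] : (forall n, 0 < s n) /\ s @ \oo --> l.
  apply: cvg_near_harmonic => // n; have := ts n; rewrite /t /s ltr_distl.
  by case: (pP n) => _ s_lt t_gt ts_n; rewrite s_lt (lt_trans t_gt).
have := zeta_limsup t s l t0 s0 tl sl l0 ts.
apply/negP; rewrite -leNgt; apply: limn_esup_ge_cst => n.
by rewrite lee_fin; apply: zeta_ge; case: (pP n).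
Qed.

Lemma Suzuki_Meir_Keeler_lt (R : realType) (X : metricType R) (f g : X -> X)
    (x y : X) :
  Suzuki_Meir_Keeler f g -> 2^-1 * mdist (g x) (f x) < mdist (g x) (g y) ->
  mdist (f x) (f y) < mdist (g x) (g y).
Proof.
move=> mk xy; have gxy0 : 0 < mdist (g x) (g y).
  by have := mdist_ge0 (g x) (f x); lra.
have [delta delta0 /(_ x y xy)] := mk _ gxy0.
by rewrite ltrDl => /(_ delta0); lra.
Qed.

Lemma Suzuki_Meir_Keeler_coincidence_uniq (R : realType) (X : metricType R)
    (f g : X -> X) (u v : X) :
  Suzuki_Meir_Keeler f g ->
  point_of_coincidence f g u -> point_of_coincidence f g v -> u = v.
Proof.
move=> mk [x [ufx ugx]] [y [vfy vgy]].
apply/eqP/negP => /negP uv.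
have := @Suzuki_Meir_Keeler_lt _ _ f g x y mk.
rewrite -ufx -ugx -vfy -vgy mdistxx mulr0 ltxx mdist_gt0 uv.
by move=> /(_ isT).
Qed.

(** * Jungck sequences *)

Definition Jungck_sequence (X : Type) (f g : X -> X) (x : nat -> X) :=
  forall n, f (x n) = g (x n.+1).

Lemma Jungck_sequence_exists (X : Type) (f g : X -> X) (x0 : X) :
  range f `<=` range g -> exists x, Jungck_sequence f g x.
Proof.
move=> fg.
have /choice[h hP] : forall a, exists b, f a = g b.
  by move=> a; have [|b _ gb] := fg (f a); [exists a|exists b].
by exists (fun n => iter n h x0) => n; rewrite /= hP.
Qed.

Section Jungck_sequence_convergence.
Context (R : realType) (X : metricType R) (f g : X -> X) (x : nat -> X)
  (mk : Suzuki_Meir_Keeler f g) (xJ : Jungck_sequence f g x)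
  (nocoinc : forall v, f v <> g v).

Let step n := mdist (g (x n)) (g (x n.+1)).

Let step_gt0 n : 0 < step n.
Proof. by rewrite mdist_gt0 -xJ; apply/eqP => /esym; exact: nocoinc. Qed.

(** The Suzuki premise at [x_n, x_(n+1)] reads [step n / 2 < step n]. *)
Let step_Suzuki n :
  2^-1 * mdist (g (x n)) (f (x n)) < mdist (g (x n)) (g (x n.+1)).
Proof. by rewrite xJ; have := step_gt0 n; rewrite /step; lra. Qed.

Lemma Jungck_step_decreasing n :
  mdist (g (x n.+1)) (g (x n.+2)) < mdist (g (x n)) (g (x n.+1)).
Proof.
by rewrite -!xJ {2}xJ; apply: Suzuki_Meir_Keeler_lt => //; exact: step_Suzuki.
Qed.

(** If the infimum of the steps were some [l > 0], then a step below
    [l + delta] would be followed by one at most [l - delta]. *)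
Lemma Jungck_step_small (e : R) : 0 < e ->
  exists N, forall n, (N <= n)%N -> mdist (g (x n)) (g (x n.+1)) < e.
Proof.
move=> e0.
have lbE : has_lbound (range step) by exists 0 => _ [n _ <-]; exact: ltW.
have infE : has_inf (range step) by split=> //; exists (step 0), 0.
have inf0 : inf (range step) <= 0.
  rewrite leNgt; apply/negP => /mk[delta delta0 mkP].
  have [_ [n _ <-]] := inf_adherent delta0 infE.
  move=> /(mkP _ _ (step_Suzuki n)); rewrite !xJ => step_le.
  have : inf (range step) <= step n.+1 by apply: ge_inf => //; exists n.+1.
  by rewrite /step; lra.
have [_ [N _ <-] stepN] := inf_adherent e0 infE.
exists N => n; elim: n => [|n IH].
  by rewrite leqn0 => /eqP N0; move: stepN; rewrite N0 /step; lra.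
rewrite leq_eqVlt => /predU1P[<-|/IH].
  by move: stepN; rewrite /step; lra.
exact/lt_trans/Jungck_step_decreasing.
Qed.

(** Induction on [m]: when the pair [x_n, x_m] satisfies the Suzuki premise, the
    Meir-Keeler gap [delta] absorbs one step; otherwise [g x_m] is within half a
    step of [g x_n]. *)
Lemma Jungck_Cauchy (e : R) : 0 < e ->
  exists N, forall n m, (N <= n)%N -> (n <= m)%N ->
    mdist (g (x n)) (g (x m)) < e.
Proof.
move=> e0; have [delta delta0 mkP] := mk e0.
have b0 : 0 < Num.min delta (e / 2) by rewrite lt_min delta0 divr_gt0.
have [N stepN] := Jungck_step_small b0.
exists N => n m Nn; elim: m => [|m IH].
  by rewrite leqn0 => /eqP ->; rewrite mdistxx.
rewrite leq_eqVlt => /predU1P[<-|]; first by rewrite mdistxx.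
rewrite ltnS => nm.
have nm_e := IH nm.
have := stepN n Nn; rewrite lt_min => /andP[nd ne].
have := stepN m (leq_trans Nn nm); rewrite lt_min => /andP[_ me].
have [sz|nsz] := ltP (2^-1 * mdist (g (x n)) (f (x n)))
                     (mdist (g (x n)) (g (x m))).
  have := mkP _ _ sz; rewrite !xJ.
  have := metric_triangle (g (x n)) (g (x n.+1)) (g (x m.+1)).
  by lra.
move: nsz; rewrite xJ.
have := metric_triangle (g (x n)) (g (x m)) (g (x m.+1)).
by lra.
Qed.

(** If the Suzuki premise for [x_n, z] failed at both [n] and [n+1], the
    triangle inequality through [g z] would give
    [step n <= (step n + step (n+1)) / 2 < step n]. *)
Lemma Jungck_Suzuki_alternative (z : X) n :
  2^-1 * mdist (g (x n)) (f (x n)) < mdist (g (x n)) (g z) \/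
  2^-1 * mdist (g (x n.+1)) (f (x n.+1)) < mdist (g (x n.+1)) (g z).
Proof.
have [|far] := ltP; first by left.
have [|far'] := ltP; first by right.
move: far far'; rewrite !xJ.
have := Jungck_step_decreasing n.
have := metric_triangle (g (x n)) (g z) (g (x n.+1)).
rewrite (metric_sym (g z)).
by lra.
Qed.

Lemma Jungck_limit_coincidence (z : X) :
  (fun n => g (x n)) @ \oo --> g z -> f z = g z.
Proof.
move=> gxz; apply: mdist_positivity; apply/eqP.
rewrite eq_le mdist_ge0 andbT; apply/ler_addgt0Pl => e e0; rewrite addr0.
have e20 : 0 < e / 2 by rewrite divr_gt0.
have [N _ NP] := metricType_numDomainType.cvgr_dist_lt gxz e20.
have close n : (N <= n)%N ->
    2^-1 * mdist (g (x n)) (f (x n)) < mdist (g (x n)) (g z) ->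
    mdist (f z) (g z) <= e.
  move=> Nn /(Suzuki_Meir_Keeler_lt mk); rewrite xJ.
  have := NP n Nn; have := NP n.+1 (leqW Nn); rewrite /=.
  rewrite !(metric_sym (g z)).
  have := metric_triangle (f z) (g (x n.+1)) (g z).
  rewrite (metric_sym (f z) (g (x n.+1))).
  by lra.
by have [|] := Jungck_Suzuki_alternative z N; apply: close => //; exact: leqW.
Qed.

End Jungck_sequence_convergence.

(** * Existence and uniqueness *)

Lemma Suzuki_Meir_Keeler_coincidence_exists (R : realType)
    (X : completeMetricType R) (f g : X -> X) :
  Suzuki_Meir_Keeler f g -> range f `<=` range g -> continuous g ->
  (forall x, f (g x) = g (f x)) -> exists v, f v = g v.
Proof.
move=> mk fg gc comm; apply: contrapT => noex.
have nocoinc v : f v <> g v by move=> fgv; apply: noex; exists v.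
have [x xJ] := Jungck_sequence_exists point fg.
have /cauchy_cvg/cvg_ex[z gxz] : cauchy ((fun n => g (x n)) @ \oo).
  apply: cauchy_exP => e e0.
  have [N NP] := Jungck_Cauchy mk xJ nocoinc e0.
  exists (g (x N)), N => //= m Nm.
  by rewrite ballEmdist; exact: NP.
(* By commutation, the iterates themselves form a Jungck sequence. *)
have gxJ : Jungck_sequence f g (g \o x) by move=> n /=; rewrite comm xJ.
apply: noex; exists z.
apply: (Jungck_limit_coincidence mk gxJ nocoinc).
exact: (cvg_comp (g \o x) g gxz (gc z)).
Qed.

Theorem theorem3p4 (R : realType) (G : R -> R -> R) (CG : R)
    (hG : C_class G) (hCG : has_property_CG G CG)
    (X : completeMetricType R) (f g : X -> X)
    (hfg : Suzuki_contraction G CG f g)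
    (hsub : range f `<=` range g)
    (hg : continuous g)
    (hcomm : forall x : X, f (g x) = g (f x)) :
  exists! u : X, point_of_coincidence f g u.
Proof.
have mk := Suzuki_contraction_Meir_Keeler hCG hfg.
have [v fgv] := Suzuki_Meir_Keeler_coincidence_exists mk hsub hg hcomm.
have gv_coinc : point_of_coincidence f g (g v) by exists v.
exists (g v); split=> // u.
exact: Suzuki_Meir_Keeler_coincidence_uniq.
Qed.
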